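(* Let $m\ge 2$ be an integer, let $G$ be an $(m-1)$-torsion free group, let $R=\bigoplus_{g\in G}R_g$ be a $G$-graded ring such that $m-1\in U(R)$, and let $I$ be a graded-nil ideal of $R$. Then $R$ is a graded $m$-nil clean ring if and only if $R/I$ is a graded $m$-nil clean ring.
   Context: Rings are associative with identity; $U(R)$ is the group of units of $R$, and $m-1$ is identified with $(m-1)\cdot 1_R$. A ring $R$ is $G$-graded ($G$ a group with identity $e$) if $R=\bigoplus_{g\in G}R_g$ with additive subgroups satisfying $R_gR_h\subseteq R_{gh}$; elements of $\bigcup_g R_g$ are homogeneous. A two-sided ideal $I$ is homogeneous if $I=\bigoplus_{g}(I\cap R_g)$; then $R/I$ is $G$-graded with components $(R/I)_g=R_g/(I\cap R_g)$. A homogeneous (two-sided) ideal is graded-nil if each of its homogeneous elements is nilpotent. An element $f$ is $m$-potent if $f^m=f$. A $G$-graded ring is graded $m$-nil clean if every homogeneous element is the sum of a homogeneous $m$-potent and a homogeneous nilpotent. A group $G$ is $k$-torsion free if $g^k=e$ implies $g=e$ for every $g\in G$. *)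

(* Defs.v *)
From HB Require Import structures.
From mathcomp Require Import all_boot all_algebra.
From mathcomp Require Import boolp.

Set Implicit Arguments.
Unset Strict Implicit.
Unset Printing Implicit Defensive.

Import GRing.Theory.
Local Open Scope ring_scope.
Local Open Scope quotient_scope.

(* Rings are pzRingType's, so the zero ring is included.  Subsets are boolean
   predicates {pred R}; with excluded middle (boolp) these are all subsets. *)

(* mathcomp's [idealr] is one-sided and proper; here ideals are two-sided and
   the whole ring is allowed. *)
HB.mixin Record isTwoSided (R : pzRingType) (S : R -> bool) := {
  ideal2Ml : forall a x : R, x \in (S : {pred R}) -> a * x \in (S : {pred R});
  ideal2Mr : forall a x : R, x \in (S : {pred R}) -> x * a \in (S : {pred R})
}.

#[short(type="ideal2")]
HB.structure Definition Ideal2 (R : pzRingType) :=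
  {S of GRing.ZmodClosed R S & isTwoSided R S}.

(* mathcomp only puts a ring structure on [Quotient.quot I] for commutative R,
   hence the alias. *)
Definition quot2 (R : pzRingType) (I : ideal2 R) : Type := Quotient.quot I.

Section RingQuotient2.
Variables (R : pzRingType) (I : ideal2 R).
Local Notation Q := (quot2 I).

HB.instance Definition _ := GRing.Zmodule.on Q.
HB.instance Definition _ := EqQuotient.on Q.

(* The canonical surjection R -> R/I. *)
Definition quot2_pi (x : R) : Q := \pi_Q x.

Definition quot2_one : Q := quot2_pi 1.
Definition quot2_mul (x y : Q) : Q := quot2_pi (repr x * repr y).

Lemma quot2_piK (q : Q) : quot2_pi (repr q) = q.
Proof. exact: reprK. Qed.

Lemma quot2_pi_surj (q : Q) : exists x, quot2_pi x = q.
Proof. by exists (repr q); apply: quot2_piK. Qed.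

Lemma quot2_eqE (x y : R) :
  (quot2_pi x == quot2_pi y) = (x - y \in (I : {pred R})).
Proof. by rewrite Quotient.idealrBE. Qed.

Lemma quot2_piD : {morph quot2_pi : x y / x + y >-> x + y}.
Proof. exact: (@Quotient.pi_add R I). Qed.

Lemma quot2_piM : {morph quot2_pi : x y / x * y >-> quot2_mul x y}.
Proof.
move=> x y; apply/eqP; rewrite quot2_eqE.
rewrite -[x * y](addrNK (x * repr (quot2_pi y))) -mulrBr -addrA -mulrBl.
have E z : z - repr (quot2_pi z) \in (I : {pred R}).
  by rewrite -quot2_eqE quot2_piK.
by apply: rpredD; [apply: ideal2Ml | apply: ideal2Mr].
Qed.

Fact quot2_mulA : associative quot2_mul.
Proof.
move=> x y z; have [x' <-] := quot2_pi_surj x.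
have [y' <-] := quot2_pi_surj y; have [z' <-] := quot2_pi_surj z.
by rewrite -!quot2_piM mulrA.
Qed.

Fact quot2_mul1 : left_id quot2_one quot2_mul.
Proof.
by move=> x; have [x' <-] := quot2_pi_surj x; rewrite -quot2_piM mul1r.
Qed.

Fact quot2_mulr1 : right_id quot2_one quot2_mul.
Proof.
by move=> x; have [x' <-] := quot2_pi_surj x; rewrite -quot2_piM mulr1.
Qed.

Fact quot2_mulDl : left_distributive quot2_mul +%R.
Proof.
move=> x y z; have [x' <-] := quot2_pi_surj x.
have [y' <-] := quot2_pi_surj y; have [z' <-] := quot2_pi_surj z.
by rewrite -quot2_piD -!quot2_piM -quot2_piD mulrDl.
Qed.

Fact quot2_mulDr : right_distributive quot2_mul +%R.
Proof.
move=> x y z; have [x' <-] := quot2_pi_surj x.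
have [y' <-] := quot2_pi_surj y; have [z' <-] := quot2_pi_surj z.
by rewrite -quot2_piD -!quot2_piM -quot2_piD mulrDr.
Qed.

HB.instance Definition _ := GRing.Zmodule_isPzRing.Build Q
  quot2_mulA quot2_mul1 quot2_mulr1 quot2_mulDl quot2_mulDr.

Fact quot2_pi_is_zmod_morphism : zmod_morphism quot2_pi.
Proof. by move=> x y; apply: (addIr (quot2_pi y)); rewrite -quot2_piD !addrNK. Qed.

Fact quot2_pi_is_monoid_morphism : monoid_morphism quot2_pi.
Proof. by split=> // x y; rewrite quot2_piM. Qed.

HB.instance Definition _ :=
  GRing.isZmodMorphism.Build R Q quot2_pi quot2_pi_is_zmod_morphism.
HB.instance Definition _ :=
  GRing.isMonoidMorphism.Build R Q quot2_pi quot2_pi_is_monoid_morphism.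

Lemma quot2_pi_eq0 (x : R) : (quot2_pi x == 0) = (x \in (I : {pred R})).
Proof. by rewrite -(rmorph0 quot2_pi) quot2_eqE subr0. Qed.

End RingQuotient2.

(* S is the internal direct sum of the family A of additive subgroups; the
   elements of the direct sum are the finite sums of the f g, f g \in A g,
   over distinct indices. *)
Definition internal_direct_sum (G : choiceType) (V : zmodType)
    (S : {pred V}) (A : G -> {pred V}) : Prop :=
  (forall x : V, x \in S <->
     exists (s : seq G) (f : G -> V),
       [/\ uniq s, forall g, f g \in A g & x = \sum_(g <- s) f g]) /\
  (forall (s : seq G) (f : G -> V),
     uniq s -> (forall g, f g \in A g) -> \sum_(g <- s) f g = 0 ->
     forall g, g \in s -> f g = 0).

Section GradedRings.
Variables (G : groupType) (R : pzRingType).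
Implicit Types (A : G -> {pred R}) (I : ideal2 R) (x y : R).

Definition is_grading A : Prop :=
  [/\ forall g, zmod_closed (A g),
      internal_direct_sum predT A &
      forall g h x y, x \in A g -> y \in A h -> x * y \in A (g * h)%g].

Definition homogeneous A x : Prop := exists g, x \in A g.

Definition nilpotent x : Prop := exists n : nat, x ^+ n = 0.

Definition mpotent (m : nat) x : Prop := x ^+ m = x.

Definition is_unit x : Prop := exists y, x * y = 1 /\ y * x = 1.

Definition graded_nil_clean (m : nat) A : Prop :=
  forall x, homogeneous A x ->
    exists f b : R,
      [/\ homogeneous A f, mpotent m f, homogeneous A b, nilpotent b
        & x = f + b].

Definition homogeneous_ideal A I : Prop :=
  internal_direct_sum I (fun g => [predI I & A g]).

Definition graded_nil A I : Prop :=
  homogeneous_ideal A I /\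
  forall x, x \in (I : {pred R}) -> homogeneous A x -> nilpotent x.

(* R_g / (I :&: R_g), seen inside R/I as the image of R_g. *)
Definition quot_comp A I (g : G) : {pred quot2 I} :=
  [pred q | `[< exists2 x, x \in A g & q = quot2_pi I x >]].

End GradedRings.

Arguments quot_comp {G R} A I g.

Definition torsion_free (k : nat) (G : groupType) : Prop :=
  forall g : G, (g ^+ k = 1)%g -> g = 1%g.

Lemma quot_comp_grading (G : groupType) (R : pzRingType) (A : G -> {pred R})
    (I : ideal2 R) :
  is_grading A -> homogeneous_ideal A I -> is_grading (quot_comp A I).
Proof.
move=> [Az [Asum Aind] AM] [Isum _].
have inP g q : q \in quot_comp A I g <->
    exists2 x, x \in A g & q = quot2_pi I x.
  by rewrite inE; split=> /asboolP.
split.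
- move=> g; split; first by apply/inP; exists 0; rewrite ?rmorph0 ?(Az g).1.
  move=> u v /inP[x Ax ->] /inP[y Ay ->]; apply/inP.
  by exists (x - y); rewrite ?rmorphB ?(Az g).2.
- split=> [q|s f us fA fs0 g gs].
    split=> // _; have [x <-] := quot2_pi_surj q.
    have [s [f [us fA ->]]] := (Asum x).1 isT.
    exists s, (fun g => quot2_pi I (f g)); rewrite rmorph_sum; split=> // g.
    by apply/inP; exists (f g).
  have /choice[x xP] : forall g, exists x, x \in A g /\ f g = quot2_pi I x.
    by move=> h; have /inP[x ? ?] := fA h; exists x.
  have xI : \sum_(h <- s) x h \in (I : {pred R}).
    rewrite -quot2_pi_eq0 rmorph_sum -[X in _ == X]fs0 /=; apply/eqP.
    by apply: eq_bigr => h _; rewrite (xP h).2.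
  have [t [y [ut yA xy]]] := (Isum _).1 xI.
  pose r := undup (s ++ t).
  have E (u : seq G) (z : G -> R) : uniq u -> {subset u <= s ++ t} ->
      \sum_(h <- u) z h = \sum_(h <- r) (if h \in u then z h else 0).
    move=> uu su; rewrite -big_mkcond -big_filter; apply: perm_big.
    apply: uniq_perm => //; first by rewrite filter_uniq ?undup_uniq.
    by move=> h; rewrite mem_filter mem_undup; case: (boolP (h \in u)) => // /su.
  have subs : {subset s <= s ++ t} by move=> h; rewrite mem_cat => ->.
  have subt : {subset t <= s ++ t} by move=> h; rewrite mem_cat orbC => ->.
  move/eqP: xy; rewrite (E s) // (E t) // -subr_eq0 -sumrB => /eqP xy.
  have {xy} := Aind r _ (undup_uniq _) _ xy => /(_ _ g).
  rewrite mem_undup subs // gs => xg.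
  have {xg} /eqP : x g - (if g \in t then y g else 0) = 0.
    apply: xg => // h.
    have [A0 AB] := Az h.
    apply: AB; case: ifP => // _; first exact: (xP h).1.
    by have /andP[] := yA h.
  rewrite subr_eq0 => /eqP xg.
  apply/eqP; rewrite (xP g).2 quot2_pi_eq0 xg; case: ifP => _; last exact: rpred0.
  by have /andP[] := yA g.
- move=> g h u v /inP[x Ax ->] /inP[y Ay ->]; apply/inP.
  by exists (x * y); rewrite ?rmorphM ?AM.
Qed.

(* Main.v *)
Require Import Defs.
From HB Require Import structures.
From mathcomp Require Import all_boot all_algebra.
From mathcomp Require Import boolp ring.

Set Implicit Arguments.
Unset Strict Implicit.
Unset Printing Implicit Defensive.

Import GRing.Theory.
Local Open Scope ring_scope.

(** Passing to [R / I] preserves homogeneity, nilpotence and [f ^+ m = f], so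
    decompositions descend.  The content is the converse, which rests on two
    facts.

    Degrees.  A nonzero homogeneous [f] of degree [h] with [f ^+ m = f] has
    [h ^+ m = h], so [h = 1] as [G] is [(m - 1)]-torsion free.  If a
    homogeneous [x] is a sum [f + b] of such an [f] and a homogeneous
    nilpotent [b], uniqueness of homogeneous components then leaves two
    possibilities: [x] is itself nilpotent, or [x], [f] and [b] all lie in the
    component of degree [1] ([nil_clean_decomp_deg]).  Applied to the image of
    [x] in [R / I], the first possibility makes [x] nilpotent, because some
    power of [x] is a homogeneous element of the graded-nil ideal [I]; then
    [x = 0 + x] is a decomposition.  Otherwise everything takes place in
    degree [1].

    Lifting.  Let [y] of degree [1] represent the [m]-potent part in [R / I].
    Then [y ^+ m - y] is in [I], hence nilpotent.  The derivative of
    [p = 'X^m - 'X] is invertible modulo [p] once [m - 1] is: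
      [(m * t ^+ (m - 1) - 1) * (m * t ^+ (m - 1) - (m - 1)) = m - 1]
    modulo [p t].  Newton's iteration therefore deforms [y] into an exact
    [m]-potent [f] with [f - y] a multiple of [y ^+ m - y]
    ([mpotent_lift]).  Each step stays in the component of degree [1], and
    [x - f] is nilpotent modulo [I], hence nilpotent.

    The Newton computation involves only [y] and the inverse of [m - 1], which
    commute, so it is carried out in a commutative ring and transported
    through the bicommutant of [y]. *)

(** * Newton iteration for the equation t ^+ m = t *)

Lemma expr_add_order2 (C : comPzRingType) (y d : C) (n : nat) :
  exists c, (y + d) ^+ n.+1 = y ^+ n.+1 + n.+1%:R * y ^+ n * d + d ^+ 2 * c.
Proof.
elim: n => [|n [c IH]]; first by exists 0; ring.
exists (n.+1%:R * y ^+ n + (y + d) * c).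
by rewrite exprS IH [y ^+ n.+2]exprS [y ^+ n.+1]exprS -[n.+2]addn1 natrD; ring.
Qed.

(** The correction is Newton's [- p y / p' y], where [1 / p' y] is replaced by
    [u * n.+2%:R * y ^+ n.+1 - 1], an inverse of [p' y] modulo [p y]. *)
Lemma mpotent_newton_step (C : comPzRingType) (n : nat) (u y : C) :
    u * n.+1%:R = 1 ->
  let p z := z ^+ n.+2 - z in
  exists c, p (y + p y * (1 - u * n.+2%:R * y ^+ n.+1)) = p y ^+ 2 * c.
Proof.
move=> un p; set v := 1 - _.
have [c Ec] := expr_add_order2 y (p y * v) n.+1.
exists (v ^+ 2 * c - u * n.+2%:R ^+ 2 * y ^+ n).
(* [u * m = 1 + u], with [m = n.+2], is what inverting [m - 1] provides. *)
have um : u * n.+2%:R = 1 + u by rewrite -[n.+2]addn1 natrD mulrDr un mulr1.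
rewrite {1}/p Ec.
(* The linear term of the expansion vanishes modulo [p y]. *)
have vE : 1 + (n.+2%:R * y ^+ n.+1 - 1) * v
          = - (u * n.+2%:R ^+ 2 * y ^+ n * p y).
  transitivity ((n.+2%:R + u * n.+2%:R) * y ^+ n.+1
                - u * n.+2%:R ^+ 2 * y ^+ n.+1 ^+ 2); first by rewrite /v; ring.
  have -> : n.+2%:R + u * n.+2%:R = u * n.+2%:R ^+ 2.
    by rewrite [in RHS]expr2 mulrA [in RHS]um mulrDl mul1r.
  by rewrite /p ![y ^+ _.+1]exprS; ring.
transitivity (p y * (1 + (n.+2%:R * y ^+ n.+1 - 1) * v) + (p y * v) ^+ 2 * c).
  by rewrite /p; ring.
by rewrite vE; ring.
Qed.

(** A Newton step squares the defect [y ^+ m - y], so finitely many steps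
    annihilate a nilpotent one.  The predicate [P] records that the iteration
    uses neither the constant [1] nor division other than by [m - 1]: it stays
    in any non-unital subring stable under [u]. *)
Lemma mpotent_lift_comm (C : comPzRingType) (P : C -> Prop) (n : nat) (u : C) :
    u * n.+1%:R = 1 ->
    (forall x y, P x -> P y -> P (x - y)) ->
    (forall x y, P x -> P y -> P (x * y)) ->
    (forall x, P x -> P (u * x)) ->
  forall y, P y -> nilpotent (y ^+ n.+2 - y) ->
  exists f c, [/\ P f, mpotent n.+2 f & f = y + (y ^+ n.+2 - y) * c].
Proof.
move=> un PB PM Pu y Py [k yk].
have P0 : P 0 by rewrite -(subrr y); apply: PB.
have PD a b : P a -> P b -> P (a + b).
  by move=> Pa Pb; rewrite -[b]opprK -[- b]sub0r; do 2!apply: (PB) => //.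
have PX a i : P a -> P (a ^+ i.+1).
  by move=> Pa; elim: i => // i IH; rewrite exprS; apply: PM.
have Pn a i : P a -> P (i%:R * a).
  move=> Pa; rewrite mulr_natl; elim: i => // i IH.
  by rewrite mulrS; apply: PD.
(* An exponent that is a power of two makes the induction on [k] halve it. *)
have {}yk : (y ^+ n.+2 - y) ^+ (2 ^ k) = 0.
  by rewrite -(subnK (ltnW (ltn_expl k (ltnSn 1)))) exprD yk mulr0.
elim: k y Py yk => [|k IH] y Py.
  rewrite expr1 => y0; exists y, 0; split=> //; last by rewrite mulr0 addr0.
  by apply/eqP; rewrite -subr_eq0 y0.
have [c Ec] := mpotent_newton_step y un.
rewrite expnS exprM => yk.
set q := y ^+ n.+2 - y in Ec yk *; set v := 1 - _ in Ec.
have Pq : P q by apply: PB => //; apply: PX.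
have Py' : P (y + q * v).
  (* Grouped so that no factor is a bare constant, which [P] may exclude. *)
  have -> : q * v = q - u * (n.+2%:R * (y ^+ n.+1 * q)) by rewrite /v; ring.
  by apply: (PD) => //; apply: (PB) => //; apply/Pu/Pn/PM => //; apply: PX.
have [|f [c' [Pf mf fE]]] := IH _ Py'; first by rewrite Ec exprMn yk mul0r.
exists f, (v + q * c * c'); split=> //.
by rewrite fE Ec; ring.
Qed.

(** * The bicommutant of an element *)

Section Bicommutant.
Variables (R : pzRingType) (y : R).

Definition bicommutant : {pred R} :=
  [pred z | `[< forall x, GRing.comm x y -> GRing.comm x z >]].

Lemma bicommutantP z :
  reflect (forall x, GRing.comm x y -> GRing.comm x z) (z \in bicommutant).
Proof. exact: asboolP. Qed.

Fact bicommutant_subring : subring_closed bicommutant.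
Proof.
split; first by apply/bicommutantP => x _; apply: commr1.
  move=> a b /bicommutantP ca /bicommutantP cb; apply/bicommutantP => x xy.
  by apply: commrB; [apply: ca | apply: cb].
move=> a b /bicommutantP ca /bicommutantP cb; apply/bicommutantP => x xy.
by apply: commrM; [apply: ca | apply: cb].
Qed.

Record bicommutant_ring :=
  Bicommutant { bicommutant_val : R; _ : bicommutant_val \in bicommutant }.

HB.instance Definition _ := [isSub for bicommutant_val].
HB.instance Definition _ := [Choice of bicommutant_ring by <:].
HB.instance Definition _ := GRing.SubChoice_isSubPzRing.Build
  R bicommutant bicommutant_ring bicommutant_subring.

(** Elements of the bicommutant commute with [y], so they lie in the commutant
    of [y], with which every other element of the bicommutant commutes. *)
Fact bicommutant_mulC : commutative (@GRing.mul bicommutant_ring).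
Proof.
move=> a b; apply: val_inj; rewrite !rmorphM /=.
have /bicommutantP cb := valP b; apply: cb; apply/commr_sym.
by have /bicommutantP ca := valP a; apply: ca.
Qed.

HB.instance Definition _ := GRing.PzRing_hasCommutativeMul.Build
  bicommutant_ring bicommutant_mulC.

End Bicommutant.

(** Since [u] is central and [y] commutes with itself, both live in the
    bicommutant of [y], where the commutative case applies. *)
Lemma mpotent_lift (R : pzRingType) (S : {pred R}) (n : nat) (u : R) :
    u * n.+1%:R = 1 -> (forall x, GRing.comm x u) ->
    zmod_closed S -> {in S &, forall x y, x * y \in S} ->
    {in S, forall x, u * x \in S} ->
  forall y, y \in S -> nilpotent (y ^+ n.+2 - y) ->
  exists f c, [/\ f \in S, mpotent n.+2 f & f = y + (y ^+ n.+2 - y) * c].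
Proof.
move=> un uC [_ SB] SM Su y Sy [k yk].
have yB : y \in bicommutant y by apply/bicommutantP.
have uB : u \in bicommutant y by apply/bicommutantP => x _; apply: uC.
pose C := bicommutant_ring y.
pose y' : C := Bicommutant yB; pose u' : C := Bicommutant uB.
have un' : u' * n.+1%:R = 1 by apply: val_inj; rewrite rmorphM rmorph_nat.
have [|||||f [c [Sf mf fE]]] :=
  @mpotent_lift_comm C (fun z => val z \in S) n u' un' _ _ _ y'.
- by move=> a b Sa Sb; rewrite rmorphB; apply: SB.
- by move=> a b Sa Sb; rewrite rmorphM; apply: SM.
- by move=> a Sa; rewrite rmorphM; apply: Su.
- exact: Sy.
- by exists k; apply: val_inj; rewrite rmorphXn rmorphB rmorphXn rmorph0.
exists (val f), (val c); split=> //; first by rewrite /mpotent -rmorphXn mf.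
by rewrite fE rmorphD rmorphM rmorphB rmorphXn.
Qed.

Lemma natr_inv_central (R : pzRingType) (n : nat) (u : R) :
  u * n%:R = 1 -> forall x, GRing.comm x u.
Proof.
move=> un x; rewrite /GRing.comm.
have cn : n%:R * u = 1 by rewrite -(commr_nat u n).
rewrite -[x * u]mul1r -un -mulrA [n%:R * _]mulrA -(commr_nat x n).
by rewrite -mulrA cn mulr1.
Qed.

(** * Degrees in a graded ring *)

Section Grading.
Variables (G : groupType) (R : pzRingType) (A : G -> {pred R}).
Hypothesis hA : is_grading A.

Let A0 g : 0 \in A g. Proof. by have [/(_ g)[]] := hA. Qed.
Let AB g x y : x \in A g -> y \in A g -> x - y \in A g.
Proof. by have [/(_ g)[_ H] _ _] := hA; apply: H. Qed.
Let AN g x : x \in A g -> - x \in A g.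
Proof. by move=> Ax; rewrite -sub0r; apply: AB. Qed.
Let AD g x y : x \in A g -> y \in A g -> x + y \in A g.
Proof. by move=> Ax Ay; rewrite -[y]opprK; apply: AB => //; apply: AN. Qed.
Let AM g h x y : x \in A g -> y \in A h -> x * y \in A (g * h)%g.
Proof. by have [_ _ H] := hA; apply: H. Qed.
Let An g x k : x \in A g -> k%:R * x \in A g.
Proof.
move=> Ax; rewrite mulr_natl; elim: k => [|k IH]; first exact: A0.
by rewrite mulrS; apply: AD.
Qed.
Let Aind (s : seq G) (f : G -> R) :
  uniq s -> (forall g, f g \in A g) -> \sum_(g <- s) f g = 0 ->
  forall g, g \in s -> f g = 0.
Proof. by have [_ [_ H] _] := hA; apply: H. Qed.

Lemma grading_exp g x k : x \in A g -> x ^+ k.+1 \in A (g ^+ k.+1)%g.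
Proof.
by move=> Ax; elim: k => // k IH; rewrite exprS expgS; apply: AM.
Qed.

Lemma grading_deg_inj g h x : x \in A g -> x \in A h -> x != 0 -> g = h.
Proof.
move=> xg xh; apply: contra_neqP => /eqP gh.
pose f k := if k == g then x else if k == h then - x else 0.
have fg : f g = x by rewrite /f eqxx.
have fh : f h = - x by rewrite /f eq_sym (negPf gh) eqxx.
rewrite -fg; apply: (@Aind [:: g; h]); rewrite ?mem_head //=.
- by rewrite inE gh.
- by move=> k; rewrite /f; do 2?case: eqP => [->|_] //; apply: AN.
- by rewrite !big_cons big_nil fg fh addr0 subrr.
Qed.

(** If [k] is [g] or [h], the other summand is a difference of two elements of
    degree [k]; otherwise [x], [y] and [- (x + y)] are a vanishing sum over
    three distinct degrees. *)
Lemma grading_add_eq0 g h k x y : x \in A g -> y \in A h -> x + y \in A k ->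
  g != h -> x = 0 \/ y = 0.
Proof.
move=> xg yh zk gh.
have [kg|kg] := eqVneq k g.
  right; apply/eqP; apply: contraNT gh => y0; apply/eqP.
  apply: grading_deg_inj y0 => //; rewrite -[y](addKr x).
  by apply: AD; [apply: AN | rewrite -kg].
have [kh|kh] := eqVneq k h.
  left; apply/eqP; apply: contraNT gh => x0; apply/eqP.
  apply: grading_deg_inj x0 => //; rewrite -[x](addrK y).
  by apply: AB; rewrite // -kh.
left.
pose f l := if l == g then x else if l == h then y
            else if l == k then - (x + y) else 0.
have fg : f g = x by rewrite /f eqxx.
have fh : f h = y by rewrite /f eq_sym (negPf gh) eqxx.
have fk : f k = - (x + y) by rewrite /f (negPf kg) (negPf kh) eqxx.
rewrite -fg; apply: (@Aind [:: g; h; k]); rewrite ?mem_head //=.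
- by rewrite !inE negb_or gh eq_sym kg eq_sym kh.
- by move=> l; rewrite /f; do 3?case: eqP => [->|_] //; apply: AN.
- by rewrite !big_cons big_nil fg fh fk addr0 addrA subrr.
Qed.

(** Multiplication by [n%:R] is injective and preserves degrees, so the
    components of [u * x] in degrees other than [g] are killed by it.  This
    gives the stability under [u] needed for the lifting without knowing that
    [1], hence [u], is homogeneous of degree [1]. *)
Lemma grading_natr_inv n (u : R) : u * n%:R = 1 ->
  forall g x, x \in A g -> u * x \in A g.
Proof.
move=> un g x Ax; have [_ [Asum _] _] := hA.
have nK (z : R) : n%:R * z = 0 -> z = 0.
  by move=> nz; rewrite -[z]mul1r -un -mulrA nz mulr0.
have [s [z [us zA uxE]]] := (Asum (u * x)).1 isT.
have xE : x = \sum_(h <- s) n%:R * z h.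
  by rewrite -mulr_sumr -uxE mulrA -(commr_nat u n) un mul1r.
(* [g] may be missing from the support [s]; then [x = 0]. *)
have [gs|gs] := boolP (g \in s).
  have z0 h : h \in s -> h != g -> z h = 0.
    move=> hs hg; apply: nK.
    have := Aind (f := fun k => n%:R * z k - (if k == g then x else 0)) us.
    move=> /(_ _ _ h hs); rewrite (negPf hg) subr0; apply.
      by move=> k; apply: AB; [apply: An | case: eqP => [->|]].
    rewrite sumrB -xE -big_mkcond /= (eq_bigr (fun=> x)) // -big_filter.
    by rewrite filter_pred1_uniq // big_seq1 subrr.
  rewrite uxE (bigD1_seq g) //= big_seq_cond big1 ?addr0 // => h /andP[].
  exact: z0.
suff -> : x = 0 by rewrite mulr0.
pose f k := if k == g then - x else n%:R * z k.
have fg : f g = - x by rewrite /f eqxx.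
apply: oppr_inj; rewrite oppr0 -fg.
apply: (@Aind (g :: s)); rewrite ?mem_head //= ?gs //.
  by move=> k; rewrite /f; case: eqP => [->|_]; [apply: AN | apply: An].
rewrite big_cons fg {1}xE -sumrN -big_split /= big_seq big1 // => h hs.
rewrite /f; case: eqP => [hg|_]; last exact: addNr.
by rewrite -hg hs in gs.
Qed.

(** If [f] is nonzero then [h ^+ n.+2 = h], so [f] has degree [1] by
    torsion-freeness; a nonzero [b] must then have the same degree, since
    otherwise [f + b] would not be homogeneous. *)
Lemma nil_clean_decomp_deg n g x f b :
    torsion_free n.+1 G -> x \in A g -> homogeneous A f -> mpotent n.+2 f ->
    homogeneous A b -> nilpotent b -> x = f + b ->
  nilpotent x \/ [/\ x \in A 1%g, f \in A 1%g & b \in A 1%g].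
Proof.
move=> hG Ax [h Af] mf [k Ab] nb xE.
have [f0|f0] := eqVneq f 0; first by left; rewrite xE f0 add0r.
have h1 : h = 1%g.
  apply: hG; apply: (@mulgI _ h); rewrite -expgS mulg1.
  apply: (@grading_deg_inj _ _ f) => //; rewrite -{1}mf.
  exact: grading_exp.
rewrite {}h1 in Af; right.
suff Ab1 : b \in A 1%g by split=> //; rewrite xE; apply: AD.
have [k1|k1] := eqVneq 1%g k; first by rewrite k1.
rewrite xE in Ax; have [fz|->] := grading_add_eq0 Af Ab Ax k1.
  by rewrite fz eqxx in f0.
exact: A0.
Qed.

End Grading.

(** * Decompositions modulo a graded-nil ideal *)

Section GradedNil.
Variables (G : groupType) (R : pzRingType) (A : G -> {pred R}) (I : ideal2 R).
Hypotheses (hA : is_grading A) (hI : graded_nil A I).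

Lemma homogeneous_quot_comp x : homogeneous A x ->
  homogeneous (quot_comp A I) (quot2_pi I x).
Proof. by case=> g Ax; exists g; apply/asboolP; exists x. Qed.

(** A power of [x] falls into [I], and powers of homogeneous elements are
    homogeneous. *)
Lemma nilpotent_quot x :
  homogeneous A x -> nilpotent (quot2_pi I x) -> nilpotent x.
Proof.
case=> g Ax [k xk].
(* A positive exponent makes the power homogeneous by [grading_exp]. *)
have xI : x ^+ k.+1 \in (I : {pred R}).
  by rewrite -quot2_pi_eq0 rmorphXn exprSr xk mul0r.
have [|l xl] := hI.2 _ xI; first by exists (g ^+ k.+1)%g; apply: grading_exp.
by exists (k.+1 * l)%N; rewrite exprM.
Qed.

Lemma graded_nil_clean_quot m :
  graded_nil_clean m A -> graded_nil_clean m (quot_comp A I).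
Proof.
move=> clA _ [g /asboolP[x Ax ->]].
have [|f [b [Af mf Ab [k bk] ->]]] := clA x; first by exists g.
exists (quot2_pi I f), (quot2_pi I b); split.
- exact: homogeneous_quot_comp.
- by rewrite /mpotent -rmorphXn mf.
- exact: homogeneous_quot_comp.
- by exists k; rewrite -rmorphXn bk rmorph0.
- exact: rmorphD.
Qed.

(** Where [x] is not nilpotent, its [m]-potent part modulo [I] has degree [1]
    and lifts inside [A 1]; the remainder is nilpotent by [nilpotent_quot]. *)
Lemma graded_nil_clean_lift n : torsion_free n.+1 G ->
    is_unit (n.+1%:R : R) ->
  graded_nil_clean n.+2 (quot_comp A I) -> graded_nil_clean n.+2 A.
Proof.
move=> hG [u [_ un]] clQ x [g Ax].
have hQ := quot_comp_grading hA hI.1.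
have [A1z A1B A1M] : [/\ 0 \in A 1%g,
    forall y z, y \in A 1%g -> z \in A 1%g -> y - z \in A 1%g
    & forall y z, y \in A 1%g -> z \in A 1%g -> y * z \in A 1%g].
  have [/(_ 1%g)[? ?] _ AM] := hA; split=> // y z Ay Az.
  by rewrite -[1%g]mulg1; apply: AM.
have nil_case : nilpotent x -> exists f b : R, [/\ homogeneous A f,
    mpotent n.+2 f, homogeneous A b, nilpotent b & x = f + b].
  move=> nx; exists 0, x; rewrite add0r /mpotent expr0n; split=> //.
    by exists 1%g.
  by exists g.
have Qx : quot2_pi I x \in quot_comp A I g by apply/asboolP; exists x.
have [|f' [b' [Qf mf Qb nb xE]]] := clQ (quot2_pi I x); first by exists g.
have [nx|[Qx1 Qf1 Qb1]] := nil_clean_decomp_deg hQ hG Qx Qf mf Qb nb xE.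
  by apply: nil_case; apply: nilpotent_quot => //; exists g.
have [x0|x0] := eqVneq (quot2_pi I x) 0.
  apply: nil_case; apply: nilpotent_quot; first by exists g.
  by exists 1%N; rewrite expr1.
have g1 := grading_deg_inj hQ Qx Qx1 x0; rewrite {}g1 in Ax.
have /asboolP[y Ay fE] := Qf1.
have [f [c [Af mf' fyc]]] : exists f c, [/\ f \in A 1%g, mpotent n.+2 f &
    f = y + (y ^+ n.+2 - y) * c].
  apply: (mpotent_lift un (natr_inv_central un)) => //.
  - by move=> z; apply: (grading_natr_inv hA un).
  - apply: nilpotent_quot; last first.
      by exists 1%N; rewrite expr1 rmorphB rmorphXn /= -fE mf subrr.
    exists 1%g; apply: A1B => //; rewrite -[1%g](expg1n _ n.+2).
    exact: grading_exp.
have piff' : quot2_pi I f = f'.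
  by rewrite fyc rmorphD rmorphM rmorphB rmorphXn /= -fE mf subrr mul0r addr0.
exists f, (x - f); split; rewrite ?[f + _]addrC ?subrK //; try by exists 1%g.
  by exists 1%g; apply: A1B.
apply: nilpotent_quot; first by exists 1%g; apply: A1B.
by rewrite rmorphB /= piff' xE addrC addKr.
Qed.

End GradedNil.

Theorem theorem3p14 (m : nat) (G : groupType) (R : pzRingType)
    (A : G -> {pred R}) (I : ideal2 R)
    (hm : (2 <= m)%N)
    (hG : torsion_free (m - 1) G)
    (hA : is_grading A)
    (hu : is_unit ((m - 1)%:R : R))
    (hI : graded_nil A I) :
  graded_nil_clean m A <-> graded_nil_clean m (quot_comp A I).
Proof.
case: m hm hG hu => [|[|n]] // _; rewrite subSS subn0 => hG hu.
by split; [apply: graded_nil_clean_quot | apply: graded_nil_clean_lift].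
Qed.
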